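(* Let $\underline P=\min_i P_{ic_i}$, $\bar P=\max_i P_{ic_i}$, and let $\mathrm{med}(P)$ and $\mathrm{avg}(P)$ be the median and mean of $\{P_{ic_i}\}_{i=1}^m$. The cut-off price vector $\mathbf p^{\mathrm{CP}}$ generates a revenue that is at least $$\max\left\{\frac{1}{1+\log(\bar P/\underline P)},\ \frac{\mathrm{med}(P)}{2\,\mathrm{avg}(P)}\right\}$$ of the optimal value $\mathrm{OPT}$ of (OP-MIP), i.e. $\mathrm{Rev}(\mathbf p^{\mathrm{CP}})\ge \max\{\cdot,\cdot\}\,\mathrm{OPT}$. Furthermore, this bound is asymptotically tight, being achieved when both the number of products and the number of customers grow to infinity: for any reals $0<P_1<P_2$ there is a sequence of instances with $n\to\infty$, $m\to\infty$, $\underline P\to P_1$, $\bar P\to P_2$, along which the difference between $\mathrm{Rev}(\mathbf p^{\mathrm{CP}})/\mathrm{OPT}$ and the bound above tends to $0$ (the limit being $1/(1+\log(P_2/P_1))$).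
   Context: There are customers $\mathscr C=\{1,\dots,m\}$ and products $\mathscr P=\{1,\dots,n\}$. Customer $i$ saw historical prices $P_{ij}>0$ and purchased product $c_i\in\mathscr P$. Let $P^{\max}=\max_iP_{ic_i}$ ($=\bar P$). (OP-MIP): maximize $\sum_{i}\bar\tau_i$ over $\mathbf p\in\mathbb R^n_+$, $\boldsymbol\tau,\bar{\boldsymbol\tau}\in\mathbb R^m_+$, $\mathbf y\in\{0,1\}^{m\times n}$ subject to, for all $i\in\mathscr C$: $\tau_i\le p_j+(1-y_{ij})P_{ic_i}$ for all $j\in\mathscr P$; $p_{c_i}\le P_{ic_i}+(P^{\max}-P_{ic_i})(1-y_{ic_i})$; $p_j-p_{c_i}\ge P_{ij}-P_{ic_i}-(P^{\max}+P_{ij}-P_{ic_i})y_{ij}$ for all $j\ne c_i$; $\bar\tau_i\le y_{ic_i}P_{ic_i}$; $\bar\tau_i\le\tau_i$; $\bar\tau_i\ge\tau_i-(1-y_{ic_i})P_{ic_i}$. The revenue of a price vector $\mathbf p$ is the value of (OP-MIP) when $\mathbf p$ is fixed, namely $$\mathrm{Rev}(\mathbf p)=\sum_{i\in\mathscr C}\mathbb I(p_{c_i}\le P_{ic_i})\cdot\min\{p_j:\ j=c_i\ \text{or}\ p_j-p_{c_i}<P_{ij}-P_{ic_i}\}.$$ Cut-off pricing: let $i^\circ\in\arg\max_{i\in\mathscr C}\sum_{i'\in\mathscr C}\mathbb I(P_{i'c_{i'}}\ge P_{ic_i})\,P_{ic_i}$ and $p^*=P_{i^\circ c_{i^\circ}}$.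 For each $j\in\mathscr P$, if the set $\{i:\ c_i=j,\ P_{ic_i}\ge p^*\}$ is nonempty, then $p^{\mathrm{CP}}_j=\min\{P_{ic_i}:\ c_i=j,\ P_{ic_i}\ge p^*\}$; otherwise $p^{\mathrm{CP}}_j=\min\{\max\{\max_{i}P_{ij},\,p^*\},\,\bar P\}$. *)

(* Defs.v *)
From mathcomp Require Import all_boot all_order all_algebra.
From mathcomp Require Import all_classical all_reals all_analysis.
Set Implicit Arguments.
Unset Strict Implicit.
Unset Printing Implicit Defensive.
Import Order.TTheory GRing.Theory Num.Theory.
Import numFieldNormedType.Exports.
Local Open Scope classical_set_scope.
Local Open Scope ring_scope.

(* There must be a customer for min, max, median and mean to make sense; then
   [bought] provides a product, so n > 0 as well. *)
Record instance (R : realType) (m n : nat) := Instance {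
  price : 'I_m -> 'I_n -> R;
  bought : 'I_m -> 'I_n;
  price_gt0 : forall i j, 0 < price i j;
  customers_gt0 : (0 < m)%N
}.

Section Pricing.
Context (R : realType) (m n : nat) (I : instance R m n).
Implicit Types (i : 'I_m) (j : 'I_n) (p : 'I_n -> R).

Local Notation P := (price I).
Local Notation c := (bought I).

Definition paid i : R := P i (c i).

(* In every iterated max/min below the initial value never affects the result:
   prices are positive, Pmax dominates all [paid] values, and the price of c_i
   is itself one of the terms of the minimum in [Rev]. *)
Definition Pmax : R := \big[Num.max/0]_i paid i.
Definition Pmin : R := \big[Num.min/Pmax]_i paid i.

Definition avgP : R := (\sum_i paid i) / m%:R.

(* For an even number of values, the mean of the two middle ones. *)
Definition medP : R :=
  let s := sort <=%R [seq paid i | i : 'I_m] in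
  if odd m then s`_(m./2) else (s`_(m./2).-1 + s`_(m./2)) / 2.

Definition OPMIP_feasible p (tau taubar : 'I_m -> R) (y : 'I_m -> 'I_n -> bool)
    : Prop :=
  (forall j, 0 <= p j) /\
  (forall i, 0 <= tau i) /\
  (forall i, 0 <= taubar i) /\
  (forall i j, tau i <= p j + (1 - (y i j)%:R) * paid i) /\
  (forall i, p (c i) <= paid i + (Pmax - paid i) * (1 - (y i (c i))%:R)) /\
  (forall i j, j != c i ->
     p j - p (c i) >=
       P i j - paid i - (Pmax + P i j - paid i) * (y i j)%:R) /\
  (forall i, taubar i <= (y i (c i))%:R * paid i) /\
  (forall i, taubar i <= tau i) /\
  (forall i, taubar i >= tau i - (1 - (y i (c i))%:R) * paid i).

(* The set is nonempty (zero prices, y = 1) and bounded by the total amount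
   paid, so [sup] is a genuine supremum. *)
Definition OPT : R :=
  sup [set v | exists p tau taubar y,
         OPMIP_feasible p tau taubar y /\ v = \sum_i taubar i].

(* Closed form of the optimal value of the same program with [p] held fixed, at
   any feasible [p]. *)
Definition Rev p : R :=
  \sum_i (p (c i) <= paid i)%R%:R *
    \big[Num.min/p (c i)]_(j | (j == c i) ||
                               (p j - p (c i) < P i j - paid i)) p j.

Definition cutoff_value i : R :=
  \sum_(i' : 'I_m) (paid i <= paid i')%R%:R * paid i.

(* Ties are possible, so the cut-off customer is specified by a predicate. *)
Definition is_cutoff i : Prop := forall i', cutoff_value i' <= cutoff_value i.

Definition pCP (io : 'I_m) : 'I_n -> R := fun j =>
  let pstar := paid io in
  if [exists i, (c i == j) && (pstar <= paid i)]
  then \big[Num.min/Pmax]_(i | (c i == j) && (pstar <= paid i)) paid i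
  else Num.min (Num.max (\big[Num.max/0]_i P i j) pstar) Pmax.

(* The logarithm is natural. *)
Definition CP_bound : R :=
  Num.max (1 / (1 + ln (Pmax / Pmin))) (medP / (2 * avgP)).

End Pricing.

(* Main.v *)
Require Import Defs.
From mathcomp Require Import all_boot all_order all_algebra.
From mathcomp Require Import all_classical all_reals all_analysis.
From mathcomp Require Import ring lra zify.
Import Order.TTheory GRing.Theory Num.Theory.
Import numFieldNormedType.Exports.
Local Open Scope classical_set_scope.
Local Open Scope ring_scope.
Set Implicit Arguments.
Unset Strict Implicit.
Unset Printing Implicit Defensive.

(**
Write V for the largest revenue [cutoff_value] that one uniform price can earn.

Guarantee.  No price is ever paid above what was paid historically, so OPT is
at most the sum S of the paid prices ([OPT_le_sum_paid]).  Under cut-off pricing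
every price is at least the cut-off p*, and each customer who paid at least p*
can afford the product bought, hence Rev is at least V
([cutoff_value_le_Rev]).  It remains to compare V with S.  Let
s_0 <= ... <= s_(m-1) be the sorted paid prices.  At least m - k customers paid
s_k or more, so (m - k) s_k <= V: the paid prices are dominated by a harmonic
sequence.  Hence S <= V + V ln (Pmax / Pmin) ([sum_paid_le]), while the middle
ranks give m/2 * med <= V ([half_med_le]); dividing by S yields the two terms of the bound.

Tightness.  Take n products and d <= n, and let lo n / max (j + 1, d) be the
price level of product j < n: these levels form an equal-revenue distribution,
since charging any one of them earns at most lo n from one customer per product.
Product j is bought by K customers paying its level and one customer paying lo.
The extra customers make lo the unique best uniform price
([two_tier_cutoff]), so cut-off pricing charges lo for everything and earns
(K + 1) n lo.  Charging each product its own level earns K times the sum of the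
levels ([two_tier_OPT_ge]), which is at least about n lo (1 + ln (n / d))
([harmonic_max_ge_ln]).  With d = K = k + 1 and n = floor ((P2 / P1) (k + 1))
the ratio Rev / OPT is squeezed between 1 / (1 + ln (P2 / P1)) and a sequence
tending to it ([tight_ratio_ge], [tight_ratio_le]).  By the guarantee, the
bound itself, median term included, lies between the limit and the ratio, so it
has the same limit.
*)

(** * Revenue of a price vector and the optimal value *)

Section Revenue.
Context (R : realType) (m n : nat) (I : instance R m n).
Implicit Types (i : 'I_m) (p : 'I_n -> R).

Lemma paid_gt0 i : 0 < paid I i. Proof. exact: price_gt0. Qed.

Lemma paid_le_Pmax i : paid I i <= Pmax I. Proof. exact: le_bigmax. Qed.

Lemma Pmin_le_paid i : Pmin I <= paid I i. Proof. exact: bigmin_le. Qed.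

Lemma Pmax_gt0 : 0 < Pmax I.
Proof.
exact: lt_le_trans (paid_gt0 _) (paid_le_Pmax (Ordinal (customers_gt0 I))).
Qed.

Lemma Pmin_gt0 : 0 < Pmin I.
Proof.
by apply/bigmin_gtP; split=> [|i _]; rewrite ?Pmax_gt0 ?paid_gt0.
Qed.

Lemma OPMIP_value_le_paid p tau taubar y :
  OPMIP_feasible I p tau taubar y -> \sum_i taubar i <= \sum_i paid I i.
Proof.
move=> [_ [_ [_ [_ [_ [_ [ub _]]]]]]]; apply: ler_sum => i _.
apply: le_trans (ub i) _; rewrite ler_piMl ?(ltW (paid_gt0 i))//.
by case: (y _ _).
Qed.

(** Each buyer pays the minimum in [Rev], with y selecting the products that
    enter this minimum.  The upper bound on [p] is what lets a customer who does
    not buy satisfy the big-M constraints. *)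
Lemma Rev_feasible p : (forall j, 0 <= p j <= Pmax I) ->
  exists tau taubar y,
    OPMIP_feasible I p tau taubar y /\ Rev I p = \sum_i taubar i.
Proof.
move=> p_itv; pose buys i := p (bought I i) <= paid I i.
pose cheap i j := (j == bought I i) ||
  (p j - p (bought I i) < price I i j - paid I i).
pose low i := \big[Num.min/p (bought I i)]_(j | cheap i j) p j.
have low_ge0 i : 0 <= low i.
  by apply: le_bigmin => [|j _]; [case/andP: (p_itv (bought I i)) | case/andP: (p_itv j)].
have low_le i : low i <= p (bought I i) by exact: bigmin_le_id.
pose t i := (buys i)%:R * low i.
(* A customer who does not buy gets y = 1 off c_i: this voids the third family of
   constraints, which only asks for p_j - p_{c_i} >= - Pmax. *)
pose y i j := if buys i then cheap i j else j != bought I i.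
have t_ge0 i : 0 <= t i by rewrite mulr_ge0.
exists t, t, y; split=> //; do !split=> //.
- by move=> j; case/andP: (p_itv j).
- move=> i j; have := p_itv j; have := paid_gt0 i; rewrite /t /y.
  case: (boolP (buys i)) => [bi|_]; last first.
    by case: (j != _) => /=; rewrite ?mul0r; lra.
  rewrite mul1r; case: (boolP (cheap i j)) => [cij|_] /=.
    by rewrite subrr mul0r addr0 => _ _; apply: bigmin_le_cond.
  by move: bi (low_le i); rewrite /buys; lra.
- move=> i; rewrite /y /cheap eqxx /=; case: (boolP (buys i)) => bi /=.
    by move: bi; rewrite /buys; lra.
  by have := p_itv (bought I i); lra.
- move=> i j /negPf jc; rewrite /y; case: (boolP (buys i)) => bi; last first.
    rewrite jc /=; have := p_itv j; have := p_itv (bought I i); lra.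
  case: (boolP (cheap i j)) => cij /=.
    rewrite mulr1; have := p_itv j; have := p_itv (bought I i); lra.
  by rewrite mulr0 subr0 leNgt; move: cij; rewrite /cheap jc.
- move=> i; rewrite /t /y /cheap eqxx /=; case: (boolP (buys i)) => bi.
    by rewrite !mul1r; apply: le_trans (low_le i) bi.
  by rewrite !mul0r.
- move=> i; rewrite gerBl mulr_ge0 ?(ltW (paid_gt0 i))//.
  by case: (y _ _); rewrite ?subrr ?subr0.
Qed.

Lemma Rev_le_OPT p : (forall j, 0 <= p j <= Pmax I) -> Rev I p <= OPT I.
Proof.
move=> /[dup] p_itv /Rev_feasible[tau [taubar [y [fy vE]]]].
apply: ub_le_sup; last by exists p, tau, taubar, y.
exists (\sum_i paid I i) => _ [p' [tau' [taubar' [y' [fy' ->]]]]].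
exact: OPMIP_value_le_paid fy'.
Qed.

Lemma OPT_le_sum_paid : OPT I <= \sum_i paid I i.
Proof.
apply: ge_sup; last first.
  by move=> _ [p [tau [taubar [y [fy ->]]]]]; exact: OPMIP_value_le_paid fy.
have [j|tau [taubar [y [fy _]]]] := @Rev_feasible (fun=> 0).
  by rewrite lexx ltW ?Pmax_gt0.
by exists (\sum_i taubar i); exists (fun=> 0), tau, taubar, y.
Qed.

(** Both branches of [pCP] stay above the cut-off: the first is a minimum over
    customers above it, the second a maximum with it. *)
Lemma pCP_ge io j : paid I io <= pCP I io j.
Proof.
rewrite /pCP; case: ifP => _.
  by apply: le_bigmin => [|i /andP[]//]; exact: paid_le_Pmax.
by rewrite le_min le_max lexx orbT paid_le_Pmax.
Qed.

Lemma pCP_le_paid io i : paid I io <= paid I i -> pCP I io (bought I i) <= paid I i.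
Proof.
move=> le_i; rewrite /pCP ifT; last by apply/existsP; exists i; rewrite eqxx.
by apply: bigmin_le_cond; rewrite eqxx.
Qed.

(** Cut-off pricing keeps every customer counted by [cutoff_value] and never
    charges less than the cut-off, whatever product sets the minimum in [Rev]. *)
Lemma cutoff_value_le_Rev io : cutoff_value I io <= Rev I (pCP I io).
Proof.
apply: ler_sum => i _; set low := \big[_/_]_(_ | _) _.
have min_ge : paid I io <= low.
  by apply: le_bigmin => [|j _]; exact: pCP_ge.
have [le_i|_] := boolP (paid I io <= paid I i).
  by rewrite pCP_le_paid// !mul1r.
rewrite mul0r mulr_ge0//; exact: le_trans (ltW (paid_gt0 io)) min_ge.
Qed.

End Revenue.

(** * Sums of sorted sequences *)

Section SortedSums.
Context (R : realType).
Implicit Types (s : seq R) (V x : R).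

Lemma sub_inv_le_ln x y : 0 < x -> 0 < y -> 1 - x / y <= ln (y / x).
Proof.
move=> x0 y0; have xy0 : 0 < x / y by rewrite divr_gt0.
have := @le_ln1Dx R (x / y - 1); rewrite addrCA subrr addr0.
have -> : y / x = (x / y)^-1 by rewrite invf_div.
by rewrite lnV ?posrE//; move=> /(_ ltac:(lra)); lra.
Qed.

(** A discrete form of integrating the survival function t |-> N(t) under the
    bound t N(t) <= V.  Removing the head [x], with N entries left and new head
    [y], adds N (y - x) to the part outside the logarithm.  This is at most
    V (1 - x / y) <= V ln (y / x), which is exactly what the logarithmic part
    loses. *)
Lemma sum_sorted_le V M x s : 0 < x -> path <=%R x s ->
    (forall y, y \in x :: s -> y <= M) ->
    (forall k, (k < size (x :: s))%N ->
       (size (x :: s) - k)%:R * (x :: s)`_k <= V) ->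
  \sum_(y <- x :: s) y <= (size (x :: s))%:R * x + V * ln (M / x).
Proof.
elim: s x => [|y s IHs] x x_gt0.
  move=> _ leM /(_ 0%N isT) /=; rewrite subn0 mulr1n mul1r big_seq1 => xV.
  rewrite lerDl mulr_ge0 ?(le_trans (ltW x_gt0) xV)// ln_ge0//.
  by rewrite ler_pdivlMr// mul1r leM// mem_head.
move=> /= /andP[xy ys] leM bound; have y_gt0 := lt_le_trans x_gt0 xy.
have M_gt0 : 0 < M by apply: lt_le_trans x_gt0 (leM x _); rewrite mem_head.
have leM' z : z \in y :: s -> z <= M by move=> zs; rewrite leM// in_cons zs orbT.
rewrite big_cons; have := IHs y y_gt0 ys leM' (fun k => bound k.+1).
have /= := bound 1%N isT; rewrite subn1 /=.
rewrite -[(size s).+2]addn1 natrD; set N : R := (size s).+1%:R.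
set S := \sum_(j <- _) _ => NyV S_le.
have -> : M / x = (M / y) * (y / x) by rewrite mulrA divfK ?gt_eqF.
rewrite lnM ?posrE ?divr_gt0//.
have step : N * (y - x) <= V * ln (y / x).
  have -> : N * (y - x) = N * y * (1 - x / y) by field; rewrite gt_eqF.
  apply: ler_pM => //; last exact: sub_inv_le_ln.
    by rewrite mulr_ge0 ?ler0n// ltW.
  by rewrite subr_ge0 ler_pdivrMr// mul1r.
rewrite mulrDr; lra.
Qed.

Lemma size_sub_le_count s k : sorted <=%R s -> (k < size s)%N ->
  (size s - k <= count (>= s`_k)%R s)%N.
Proof.
move=> s_sorted ks; set x := s`_k.
rewrite -(size_drop k) -[in X in (_ <= X)%N](cat_take_drop k s) count_cat.
apply: leq_trans (leq_addl _ _); rewrite leq_eqVlt; apply/orP; left.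
rewrite eq_sym -all_count; apply/(all_nthP 0) => i; rewrite size_drop ltn_subRL => iks.
by rewrite nth_drop /x; apply: (le_sorted_leq_nth 0 s_sorted); rewrite ?inE ?leq_addr.
Qed.

End SortedSums.

(** * The guarantee of cut-off pricing *)

Section Guarantee.
Context (R : realType) (m n : nat) (I : instance R m n).
Implicit Types (i io : 'I_m).

Let s := sort <=%R [seq paid I i | i : 'I_m].

Let size_s : size s = m.
Proof. by rewrite size_sort size_map -cardE card_ord. Qed.

Let s_sorted : sorted <=%R s.
Proof. exact: sort_sorted (@le_total _ _) _. Qed.

Let mem_s x : x \in s -> exists i, x = paid I i.
Proof. by rewrite mem_sort => /mapP[i _ ->]; exists i. Qed.

Let sum_s : \sum_(x <- s) x = \sum_i paid I i.
Proof.
by rewrite (perm_big _ (permEl (perm_sort _ _))) big_image.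
Qed.

Lemma cutoff_valueE i : cutoff_value I i = (count (>= paid I i) s)%:R * paid I i.
Proof.
rewrite /cutoff_value -mulr_suml -natr_sum; congr (_%:R * _).
rewrite count_sort -sum1_count big_image_cond [RHS]big_mkcond.
by apply: eq_bigr => j _ /=; case: (_ <= _).
Qed.

(** Charging everybody s_k loses at most the k customers of lower rank. *)
Lemma rank_mul_paid_le io k : is_cutoff I io -> (k < m)%N ->
  (m - k)%:R * s`_k <= cutoff_value I io.
Proof.
move=> io_opt km; have /mem_s[i si] : s`_k \in s by rewrite mem_nth ?size_s.
apply: le_trans (io_opt i); rewrite cutoff_valueE -si ler_wpM2r//.
  by rewrite si ltW ?paid_gt0.
by rewrite ler_nat -[X in (X - _)%N]size_s size_sub_le_count ?size_s.
Qed.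

(** The first term m s_0 of [sum_sorted_le] is itself at most V, by the rank
    bound at k = 0. *)
Lemma sum_paid_le io : is_cutoff I io ->
  \sum_i paid I i <= cutoff_value I io * (1 + ln (Pmax I / Pmin I)).
Proof.
move=> io_opt; have := @rank_mul_paid_le _ _ io_opt.
rewrite -sum_s; move: mem_s size_s s_sorted; case: s => [|x t].
  by move=> _ m0; have := customers_gt0 I; rewrite -{1}m0.
set V := cutoff_value I io => mem sz st bound.
have [i xi] := mem _ (mem_head _ _); have x_gt0 : 0 < x by rewrite xi paid_gt0.
have := @sum_sorted_le _ V (Pmax I) x t x_gt0 st.
rewrite sz => /(_ _ bound) le_sum.
apply: le_trans (le_sum _) _ => [y /mem[j ->]|]; first exact: paid_le_Pmax.
have mx : m%:R * x <= V by have := bound 0%N (customers_gt0 I); rewrite subn0.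
have V_ge0 : 0 <= V by apply: le_trans mx; rewrite mulr_ge0 ?ler0n ?ltW.
rewrite mulrDr mulr1 lerD// ler_wpM2l// ler_ln ?posrE ?divr_gt0 ?Pmax_gt0 ?Pmin_gt0//.
rewrite ler_pM2l ?Pmax_gt0 // lef_pV2 ?posrE ?Pmin_gt0//.
by rewrite xi Pmin_le_paid.
Qed.

(** For odd m = 2h + 1, rank h alone suffices.  For m = 2h, ranks h - 1 and h
    give V >= (h + 1) s_(h-1) and V >= h s_h, and averaging them bounds h times
    the mean of the two middle values. *)
Lemma half_med_le io : is_cutoff I io ->
  m%:R / 2 * medP I <= cutoff_value I io.
Proof.
move=> io_opt; have bound := @rank_mul_paid_le _ _ io_opt.
have m_gt0 := customers_gt0 I.
rewrite /medP -/s; have := odd_double_half m.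
case: (boolP (odd m)) => /= odd_m; set h := m./2 => mE.
  have hm : (h < m)%N by lia.
  have := bound h hm; have -> : (m - h = h + 1)%N by lia.
  have : 0 < s`_h by have /mem_s[i ->] : s`_h \in s;
    rewrite ?mem_nth ?size_s ?paid_gt0.
  have -> : m%:R = 1 + h%:R + h%:R :> R by rewrite -[in LHS]mE -addnn addnA !natrD.
  by rewrite natrD; nra.
have hm : (h < m)%N by lia.
have hm1 : (h.-1 < m)%N by lia.
have := bound h hm; have -> : (m - h = h)%N by lia.
have := bound h.-1 hm1; have -> : (m - h.-1 = h + 1)%N by lia.
have : 0 < s`_h.-1 by have /mem_s[i ->] : s`_h.-1 \in s;
  rewrite ?mem_nth ?size_s ?paid_gt0.
have -> : m%:R = h%:R + h%:R :> R by rewrite -[in LHS]mE add0n -addnn natrD.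
by rewrite natrD; nra.
Qed.

Lemma CP_bound_OPT_le_Rev io : is_cutoff I io ->
  CP_bound I * OPT I <= Rev I (pCP I io).
Proof.
move=> io_opt; apply: le_trans (cutoff_value_le_Rev I io).
have sum_gt0 : 0 < \sum_i paid I i.
  by rewrite (bigD1 io)//= ltr_wpDr ?paid_gt0 ?sumr_ge0// => i _; rewrite ltW ?paid_gt0.
have ln_ge : 0 <= ln (Pmax I / Pmin I).
  rewrite ln_ge0// ler_pdivlMr ?Pmin_gt0// mul1r.
  exact: le_trans (Pmin_le_paid I io) (paid_le_Pmax I io).
have bound_ge0 : 0 <= CP_bound I by rewrite le_max divr_ge0//; lra.
apply: le_trans (ler_wpM2l bound_ge0 (OPT_le_sum_paid I)) _.
rewrite /CP_bound maxr_pMl ?(ltW sum_gt0)// ge_max; apply/andP; split.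
  by rewrite mulrAC mul1r ler_pdivrMr ?sum_paid_le//; lra.
have := half_med_le io_opt; rewrite /avgP; congr (_ <= _).
have m_neq0 : m%:R != 0 :> R by rewrite pnatr_eq0 -lt0n (customers_gt0 I).
by field; rewrite m_neq0 gt_eqF.
Qed.

End Guarantee.

(** * Instances with two kinds of customers *)

Section TwoTier.
(** For each product j, customer (a, j) buys it, at price [lo] if a = 0 and at
    [hi j] for the K other values of a.  Every price of a product that a customer
    does not buy is [lo], so that no product looks cheaper than the one bought
    when all products are sold at their [hi] price. *)
Context (R : realType) (n K : nat) (lo : R) (hi : 'I_n -> R).
Hypotheses (lo_gt0 : 0 < lo) (lo_le_hi : forall j, lo <= hi j) (n_gt0 : (0 < n)%N).

Let role := ('I_K.+1 * 'I_n)%type.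
Implicit Types (i io : 'I_#|{: role}|) (j : 'I_n).

Definition two_tier_price i j : R :=
  if ((enum_val i).1 != ord0) && (j == (enum_val i).2) then hi j else lo.

Let two_tier_price_gt0 i j : 0 < two_tier_price i j.
Proof.
by rewrite /two_tier_price; case: ifP => // _; exact: lt_le_trans (lo_le_hi j).
Qed.

Let two_tier_customers_gt0 : (0 < #|{: role}|)%N.
Proof. by rewrite card_prod !card_ord muln_gt0 n_gt0. Qed.

Definition two_tier : instance R #|{: role}| n :=
  Instance (fun i => (enum_val i).2) two_tier_price_gt0 two_tier_customers_gt0.

Let sum_customers (F : role -> R) :
  \sum_(i < #|{: role}|) F (enum_val i) = \sum_a \sum_j F (a, j).
Proof.
rewrite pair_bigA -(@big_enum_val _ _ _ _ {: role} F) /=.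
by apply: eq_big => // -[].
Qed.

Definition role_paid (a : role) : R := if a.1 != ord0 then hi a.2 else lo.

Lemma two_tier_paidE i : paid two_tier i = role_paid (enum_val i).
Proof. by rewrite /paid /= /two_tier_price eqxx andbT. Qed.

Lemma two_tier_paid_rank a : paid two_tier (enum_rank a) = role_paid a.
Proof. by rewrite two_tier_paidE enum_rankK. Qed.

Lemma lo_le_two_tier_paid i : lo <= paid two_tier i.
Proof. by rewrite two_tier_paidE /role_paid; case: ifP. Qed.

Lemma two_tier_Pmin : Pmin two_tier = lo.
Proof.
apply/le_anti/andP; split.
  have -> : lo = paid two_tier (enum_rank (ord0, Ordinal n_gt0)).
    by rewrite two_tier_paid_rank.
  exact: Pmin_le_paid.
apply: le_bigmin => [|i _]; last exact: lo_le_two_tier_paid.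
have io : 'I_#|{: role}| := Ordinal two_tier_customers_gt0.
exact: le_trans (lo_le_two_tier_paid io) (paid_le_Pmax _ _).
Qed.

Lemma two_tier_Pmax j0 : (0 < K)%N -> (forall j, hi j <= hi j0) ->
  Pmax two_tier = hi j0.
Proof.
move=> K_gt0 j0_max; apply/le_anti/andP; split.
  apply: bigmax_le => [|i _]; first exact: ltW (lt_le_trans lo_gt0 (lo_le_hi _)).
  by rewrite two_tier_paidE /role_paid; case: ifP.
have -> : hi j0 = paid two_tier (enum_rank (ord_max, j0)).
  by rewrite two_tier_paid_rank /role_paid /= -val_eqE /= -lt0n K_gt0.
exact: paid_le_Pmax.
Qed.

(** The price vector [hi] is fully paid by the customers with a != 0. *)
Lemma two_tier_OPT_ge : (0 < K)%N -> K%:R * \sum_j hi j <= OPT two_tier.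
Proof.
move=> K_gt0; apply: (@le_trans _ _ (Rev two_tier hi)); last first.
  apply: Rev_le_OPT => j; rewrite (le_trans (ltW lo_gt0) (lo_le_hi j))/=.
  have -> : hi j = paid two_tier (enum_rank (ord_max, j)).
    by rewrite two_tier_paid_rank /role_paid /= -val_eqE /= -lt0n K_gt0.
  exact: paid_le_Pmax.
pose G (a : role) := (a.1 != ord0)%:R * hi a.2.
have -> : K%:R * \sum_j hi j = \sum_(i < #|{: role}|) G (enum_val i).
  rewrite sum_customers big_ord_recl /= [X in _ = X + _]big1 ?add0r; last first.
    by move=> j _; rewrite /G eqxx mul0r.
  rewrite [RHS](eq_bigr (fun=> \sum_j hi j)) => [|a _].
    by rewrite sumr_const card_ord mulr_natl.
  by apply: eq_bigr => j _; rewrite /G /= mul1r.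
apply: ler_sum => i _; rewrite two_tier_paidE /G /role_paid /=.
case: eqP => _ /=.
  rewrite mul0r mulr_ge0//; apply: le_bigmin => [|j _];
  exact: le_trans (ltW lo_gt0) (lo_le_hi _).
rewrite lexx !mul1r; apply: le_bigmin => // j; rewrite /two_tier_price.
case: eqP => [->//|_] /=; rewrite andbF ltrD2r.
by move=> /(le_lt_trans (lo_le_hi j)); rewrite ltxx.
Qed.

(** Every product has a buyer at [lo], hence a cut-off of [lo] drags all prices
    down to [lo]. *)
Lemma two_tier_pCP io j : paid two_tier io = lo -> pCP two_tier io j = lo.
Proof.
move=> io_lo; apply/le_anti/andP; split; last by rewrite -[leLHS]io_lo pCP_ge.
have := @pCP_le_paid _ _ _ two_tier io (enum_rank (ord0, j)).
have -> : bought two_tier (enum_rank (ord0, j)) = j by rewrite /= enum_rankK.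
by rewrite two_tier_paid_rank io_lo /role_paid eqxx lexx; exact.
Qed.

Lemma two_tier_Rev_pCP_le io : paid two_tier io = lo ->
  Rev two_tier (pCP two_tier io) <= K.+1%:R * n%:R * lo.
Proof.
move=> io_lo; have -> : K.+1%:R * n%:R * lo = \sum_(i < #|{: role}|) lo.
  by rewrite sumr_const card_ord card_prod !card_ord -natrM mulr_natl.
apply: ler_sum => i _; apply: le_trans (_ : 1 * lo <= _); last by rewrite mul1r.
apply: ler_pM => //; last 2 first.
- by rewrite lern1 leq_b1.
- by rewrite -[leRHS](two_tier_pCP (bought two_tier i) io_lo) bigmin_le_id.
by apply: le_bigmin => [|j _]; rewrite two_tier_pCP// ltW.
Qed.

(** A uniform price [hi j] above [lo] reaches only the customers with a != 0 and
    earns at most K n lo, strictly less than the (K + 1) n lo earned by [lo]. *)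
Lemma two_tier_cutoff io :
    (forall j, (\sum_j' (hi j <= hi j')%R%:R) * hi j <= n%:R * lo) ->
  is_cutoff two_tier io -> paid two_tier io = lo.
Proof.
move=> tier_rev io_opt; apply: contrapT => /eqP io_neq_lo.
have io_gt_lo : lo < paid two_tier io.
  by rewrite lt_neqAle eq_sym io_neq_lo lo_le_two_tier_paid.
have := io_opt (enum_rank (ord0, Ordinal n_gt0)); apply/negP; rewrite -ltNge.
rewrite /cutoff_value two_tier_paid_rank.
have -> : role_paid (ord0, Ordinal n_gt0) = lo by [].
have -> : \sum_(i' < #|{: role}|) (lo <= paid two_tier i')%R%:R * lo =
    K.+1%:R * n%:R * lo.
  rewrite (eq_bigr (fun=> lo)) => [|i _]; last by rewrite lo_le_two_tier_paid mul1r.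
  by rewrite sumr_const card_ord card_prod !card_ord -natrM mulr_natl.
apply: le_lt_trans (_ : K%:R * (n%:R * lo) < _); last first.
  by rewrite -addn1 natrD -mulrA mulrDl mul1r ltrDl mulr_gt0 ?ltr0n.
have paidE : paid two_tier io = hi (enum_val io).2.
  move: io_gt_lo; rewrite two_tier_paidE /role_paid.
  by case: ifP => // _; rewrite ltxx.
pose G (a : role) : R := (paid two_tier io <= role_paid a)%R%:R.
rewrite -mulr_suml (eq_bigr (fun i => G (enum_val i))) => [|i _]; last first.
  by rewrite (two_tier_paidE i).
rewrite sum_customers big_ord_recl [X in X + _]big1 ?add0r; last first.
  by move=> j _; rewrite /G leNgt io_gt_lo.
rewrite (eq_bigr (fun=> \sum_j' (paid two_tier io <= hi j')%R%:R)) //.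
rewrite sumr_const card_ord -[_ *+ K]mulr_natl -mulrA ler_wpM2l ?ler0n//.
rewrite paidE; exact: tier_rev.
Qed.

End TwoTier.

(** * Equal-revenue price levels *)

Section EqualRevenue.
Context (R : realType).

(** The first d terms add up to 1; each further 1 / N exceeds
    ln (1 + 1 / N), and these logarithms telescope. *)
Lemma harmonic_max_ge_ln (d e : nat) : (0 < d)%N ->
  1 + ln ((d + e).+1%:R / d.+1%:R) <=
    \sum_(j < d + e) (maxn j.+1 d)%:R^-1 :> R.
Proof.
move=> d_gt0; elim: e => [|e IHe].
  rewrite addn0 divff ?pnatr_eq0// ln1 addr0.
  rewrite (eq_bigr (fun=> d%:R^-1)) => [|j _]; last by rewrite (maxn_idPr _).
  by rewrite sumr_const card_ord -[leRHS]mulr_natl divff// pnatr_eq0 -lt0n.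
rewrite addnS big_ord_recr /= (maxn_idPl _); last by rewrite ltnW// ltnS leq_addr.
set N := (d + e).+1 in IHe *.
have N_gt0 : 0 < N%:R :> R by rewrite ltr0n.
have -> : N.+1%:R / d.+1%:R = (1 + N%:R^-1) * (N%:R / d.+1%:R) :> R.
  by rewrite mulrA; congr (_ / _); rewrite mulrDl mul1r mulVf ?gt_eqF// natr1.
rewrite lnM ?posrE ?divr_gt0 ?addr_gt0 ?invr_gt0 ?ltr0n//.
have invN_gt0 : 0 < N%:R^-1 :> R by rewrite invr_gt0.
by have := @le_ln1Dx R N%:R^-1 ltac:(lra); lra.
Qed.

(** A power law in the rank, lo n / (j + 1), capped at lo n / d, so that the
    highest level can be tuned through n / d. *)
Definition equal_revenue_price (lo : R) (n d : nat) (j : 'I_n) : R :=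
  lo * n%:R / (maxn j.+1 d)%:R.

Context (lo : R) (n d : nat).
Hypotheses (lo_gt0 : 0 < lo) (d_gt0 : (0 < d)%N) (dn : (d <= n)%N).
Local Notation hi := (@equal_revenue_price lo n d).

Lemma lo_le_equal_revenue j : lo <= hi j.
Proof.
rewrite /equal_revenue_price ler_pdivlMr ?ltr0n ?leq_max//.
by rewrite ler_pM2l// ler_nat geq_max ltn_ord.
Qed.

(** A level reaching [hi j] requires j' < max (j + 1, d), and [hi j] is lo n over
    exactly this count. *)
Lemma equal_revenue_sum (j : 'I_n) :
  (\sum_j' (hi j <= hi j')%R%:R) * hi j <= n%:R * lo.
Proof.
set D := maxn j.+1 d; have D_gt0 : 0 < D%:R :> R by rewrite ltr0n leq_max.
have hi_gt0 j' : 0 < hi j' by exact: lt_le_trans lo_gt0 (lo_le_equal_revenue j').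
have n_gt0 : 0 < n%:R :> R by rewrite ltr0n (leq_trans d_gt0).
suff le_D : \sum_j' (hi j <= hi j')%R%:R <= D%:R :> R.
  apply: le_trans (_ : D%:R * hi j <= _); first by rewrite ler_wpM2r// ltW.
  by rewrite /equal_revenue_price -/D mulrC divfK ?gt_eqF// mulrC.
rewrite -natr_sum ler_nat.
apply: leq_trans (_ : \sum_(j' < n) (j' < D) <= _)%N.
  apply: leq_sum => j' _; rewrite /equal_revenue_price.
  rewrite ler_pM2l ?mulr_gt0// lef_pV2 ?posrE ?ltr0n ?leq_max//= ler_nat geq_max -/D.
  by rewrite -leq_max -/D; case: (j' < D)%N => //=; exact: leq_b1.
suff -> : (\sum_(j' < n) (j' < D) = minn n D)%N by exact: geq_minr.
by elim: (n) => [|k IHk]; rewrite ?big_ord0 ?min0n// big_ord_recr /= IHk; lia.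
Qed.

End EqualRevenue.

(** * The tight sequence of instances *)

Section Tightness.
Context (R : realType) (lo up : R).
Hypotheses (lo_gt0 : 0 < lo) (lo_lt_up : lo < up).

Let r := up / lo.

Definition num_products (k : nat) : nat := Num.truncn (r * k.+1%:R).

Let r_gt1 : 1 < r. Proof. by rewrite /r ltr_pdivlMr ?mul1r. Qed.

Let r_gt0 : 0 < r. Proof. exact: lt_trans r_gt1. Qed.

Let num_products_itv k :
  (num_products k)%:R <= r * k.+1%:R < (num_products k)%:R + 1.
Proof. by rewrite natr1 truncn_itv// mulr_ge0// ltW// (lt_trans ltr01). Qed.

Lemma leq_num_products k : (k.+1 <= num_products k)%N.
Proof.
have := num_products_itv k; rewrite natr1 -ltnS -(ltr_nat R) => /andP[_].
by apply: le_lt_trans; rewrite ler_peMl// ltW.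
Qed.

Let level k := @equal_revenue_price R lo (num_products k) k.+1.

Definition tight_instance k :=
  @two_tier R (num_products k) k.+1 lo (@level k) lo_gt0
    (lo_le_equal_revenue lo_gt0 (leq_num_products k))
    (leq_trans (ltn0Sn k) (leq_num_products k)).

Lemma tight_Pmin k : Pmin (tight_instance k) = lo.
Proof. exact: two_tier_Pmin. Qed.

Lemma tight_Pmax k : Pmax (tight_instance k) = lo * (num_products k)%:R / k.+1%:R.
Proof.
have n_gt0 := leq_trans (ltn0Sn k) (leq_num_products k).
rewrite (@two_tier_Pmax _ _ _ _ _ _ _ _ (Ordinal n_gt0)) // => [|j].
  by rewrite /level /equal_revenue_price /= (maxn_idPr _).
rewrite /level /equal_revenue_price ler_pM2l ?mulr_gt0 ?ltr0n//.
rewrite lef_pV2 ?posrE ?ltr0n ?leq_max ?orbT //.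
by rewrite -?leq_max ler_nat (maxn_idPr _)// leq_max leqnn orbT.
Qed.

Lemma tight_Pmax_le k : Pmax (tight_instance k) <= up.
Proof.
rewrite tight_Pmax ler_pdivrMr ?ltr0n//; case/andP: (num_products_itv k) => + _.
by rewrite /r mulrAC ler_pdivlMr// mulrC.
Qed.

Lemma tight_Pmax_ge k : up - lo * harmonic k <= Pmax (tight_instance k).
Proof.
rewrite tight_Pmax lerBlDr -mulrDl ler_pdivlMr ?ltr0n//.
case/andP: (num_products_itv k) => _ /ltW.
by rewrite /r mulrAC ler_pdivrMr// mulrDl mul1r [lo * _]mulrC.
Qed.

Let ln_r_gt0 : 0 < ln r. Proof. by rewrite ln_gt0. Qed.

(** Rounding n down costs at most 1 / (k + 1): since n + 1 > r (k + 1),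
    the logarithm of (n + 1) / (k + 2) is at least
    ln r - ln ((k + 2) / (k + 1)) >= ln r - 1 / (k + 1). *)
Lemma tight_OPT_ge k :
  k.+1%:R * (lo * (num_products k)%:R * (1 + ln r - harmonic k)) <=
    OPT (tight_instance k).
Proof.
apply: le_trans (two_tier_OPT_ge _ _ _ _); last by [].
rewrite ler_wpM2l// /level /equal_revenue_price -mulr_sumr.
rewrite ler_pM2l ?mulr_gt0 ?ltr0n ?(leq_trans _ (leq_num_products k))//.
have := @harmonic_max_ge_ln R k.+1 (num_products k - k.+1) isT.
rewrite subnKC ?leq_num_products// => sum_ge; apply: le_trans sum_ge.
rewrite -addrA lerD2l.
apply: (@le_trans _ _ (ln (r * (k.+1%:R / k.+2%:R)))); last first.
  have := num_products_itv k => /andP[_ /ltW n_ge].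
  rewrite ler_ln ?posrE ?mulr_gt0 ?invr_gt0 ?ltr0n// ?(lt_trans lo_gt0 lo_lt_up)//.
  by rewrite mulrA ler_pM2r ?invr_gt0 ?ltr0n// -[(num_products k).+1%:R]natr1.
rewrite [ln (r * _)]lnM ?posrE ?(divr_gt0 (ltr0Sn _ _) (ltr0Sn _ _))// ?r_gt0// lerD2l.
apply: le_trans (sub_inv_le_ln _ _); rewrite ?ltr0n//.
by rewrite -[k.+2%:R]natr1 mulrDl divff ?pnatr_eq0// mul1r opprD addrA subrr add0r.
Qed.

Lemma tight_OPT_gt0 k : 0 < OPT (tight_instance k).
Proof.
have n_gt0 := leq_trans (ltn0Sn k) (leq_num_products k).
apply: lt_le_trans (tight_OPT_ge k); rewrite !mulr_gt0 ?ltr0n//.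
have : harmonic k <= 1 :> R by rewrite /harmonic invf_le1 ?ler1n ?ltr0n.
by have := ln_r_gt0; lra.
Qed.

(** Rounding down also ensures Pmax / Pmin <= r, so the logarithmic bound of
    every instance is already at least its limit. *)
Lemma tight_ratio_ge k io : is_cutoff (tight_instance k) io ->
  1 / (1 + ln r) <= CP_bound (tight_instance k) /\
  CP_bound (tight_instance k) <=
    Rev (tight_instance k) (pCP (tight_instance k) io) / OPT (tight_instance k).
Proof.
move=> io_opt; split; last first.
  by rewrite ler_pdivlMr ?tight_OPT_gt0// CP_bound_OPT_le_Rev.
rewrite le_max; apply/orP; left; rewrite tight_Pmin !mul1r.
have Pmax_ge : lo <= Pmax (tight_instance k).
  by rewrite -[leLHS](tight_Pmin k) (le_trans (Pmin_le_paid _ io)) ?paid_le_Pmax.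
have ratio_ge1 : 1 <= Pmax (tight_instance k) / lo by rewrite ler_pdivlMr ?mul1r.
have := ln_ge0 ratio_ge1 => ln_ge.
rewrite lef_pV2 ?posrE; [|have := ln_r_gt0; lra|lra].
rewrite lerD2l ler_ln ?posrE ?(lt_le_trans ltr01 ratio_ge1)//.
by rewrite ler_pM2r ?invr_gt0// tight_Pmax_le.
Qed.

Lemma tight_ratio_le k io : is_cutoff (tight_instance k) io ->
  Rev (tight_instance k) (pCP (tight_instance k) io) / OPT (tight_instance k) <=
    (1 + harmonic k) / (1 + ln r - harmonic k).
Proof.
move=> io_opt.
have den_gt0 : 0 < 1 + ln r - harmonic k.
  have : harmonic k <= 1 :> R by rewrite /harmonic invf_le1 ?ler1n ?ltr0n.
  by have := ln_r_gt0; lra.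
have io_lo : paid (tight_instance k) io = lo.
  by apply: two_tier_cutoff io_opt => j; exact: equal_revenue_sum (leq_num_products k) j.
rewrite ler_pdivrMr ?tight_OPT_gt0//; apply: le_trans (two_tier_Rev_pCP_le io_lo) _.
rewrite [leRHS]mulrAC ler_pdivlMr//.
apply: le_trans (ler_wpM2l _ (tight_OPT_ge k)); last by rewrite addr_ge0// harmonic_ge0.
rewrite le_eqVlt; apply/orP; left; apply/eqP.
have -> : k.+2%:R = (1 + harmonic k) * k.+1%:R :> R.
  by rewrite mulrDl mul1r mulVf ?pnatr_eq0// natr1.
ring.
Qed.

Lemma cvg_upper_ratio :
  (1 + harmonic k) / (1 + ln r - harmonic k) @[k --> \oo] --> 1 / (1 + ln r).
Proof.
have h0 := @cvg_harmonic R.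
apply: cvgM.
  by rewrite -[X in _ --> X]addr0; apply: cvgD => //; exact: cvg_cst.
apply: cvgV; first by rewrite gt_eqF//; have := ln_r_gt0; lra.
by rewrite -[X in _ --> X]subr0; apply: cvgB => //; exact: cvg_cst.
Qed.

End Tightness.

Theorem proposition10 (R : realType) :
  (forall (m n : nat) (I : instance R m n) (io : 'I_m),
     is_cutoff I io ->
     Rev I (pCP I io) >= CP_bound I * OPT I) /\
  (forall P1 P2 : R, 0 < P1 -> P1 < P2 ->
     exists (m n : nat -> nat) (I : forall k : nat, instance R (m k) (n k)),
       n k @[k --> \oo] --> \oo /\
       m k @[k --> \oo] --> \oo /\
       Pmin (I k) @[k --> \oo] --> P1 /\
       Pmax (I k) @[k --> \oo] --> P2 /\
       (forall io : forall k : nat, 'I_(m k),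
          (forall k : nat, is_cutoff (I k) (io k)) ->
          Rev (I k) (pCP (I k) (io k)) / OPT (I k) - CP_bound (I k)
            @[k --> \oo] --> (0 : R) /\
          Rev (I k) (pCP (I k) (io k)) / OPT (I k)
            @[k --> \oo] --> 1 / (1 + ln (P2 / P1)))).
Proof.
split=> [m n I io|P1 P2 P1_gt0 P12]; first exact: CP_bound_OPT_le_Rev.
have n_cvg : num_products P1 P2 k @[k --> \oo] --> \oo.
  apply/cvgnyPge => A; exists A => // k /= Ak.
  exact: leq_trans (leqW Ak) (leq_num_products P1_gt0 P12 k).
exists (fun k => #|{: 'I_k.+2 * 'I_(num_products P1 P2 k)}|), (num_products P1 P2),
  (tight_instance P1_gt0 P12).
have near_cond (Q : nat -> Prop) : (forall k, Q k) -> \forall k \near \oo, Q k.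
  by move=> allQ; exists 0%N.
split=> //; split.
  apply/cvgnyPge => A; have /cvgnyPge/(_ A)[N _ NP] := n_cvg.
  exists N => // k /NP /= An; rewrite card_prod !card_ord.
  exact: leq_trans An (leq_pmull _ _).
split; first by under eq_fun do rewrite tight_Pmin; exact: cvg_cst.
split.
  apply: (@squeeze_cvgr _ _ _ _ (fun k => P2 - P1 * harmonic k) (fun=> P2)).
  - by apply: near_cond => k; rewrite tight_Pmax_ge tight_Pmax_le.
  - rewrite -[X in _ --> X]subr0 -[X in _ - X](mulr0 P1).
    by apply: cvgB; [exact: cvg_cst|apply: cvgMr; exact: cvg_harmonic].
  - exact: cvg_cst.
move=> io io_opt.
have upper := cvg_upper_ratio P1_gt0 P12.
split; last first.
  apply: (squeeze_cvgr _ (cvg_cst _) upper); apply: near_cond => k.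
  have [lb1 lb2] := tight_ratio_ge (io_opt k).
  by rewrite (le_trans lb1 lb2) tight_ratio_le.
apply: (squeeze_cvgr _ (cvg_cst _) _ (h := fun k =>
   (1 + harmonic k) / (1 + ln (P2 / P1) - harmonic k) - 1 / (1 + ln (P2 / P1)))).
  apply: near_cond => k; have [lb1 lb2] := tight_ratio_ge (io_opt k).
  by rewrite subr_ge0 lb2 lerB// tight_ratio_le.
rewrite -[X in _ --> X](subrr (1 / (1 + ln (P2 / P1)))).
by apply: cvgB => //; exact: cvg_cst.
Qed.
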